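(* Let $\mathbf v_{(-)}=(\rho,\vec v,T,\vec B,\psi)^T$ be the primitive-variable state at a solid-wall boundary node, with $\rho>0$, $T>0$, let $\vec n$ be the unit outward normal to the wall and $\vec B^0$ the prescribed external magnetic field at the node, and define the ghost state in primitive variables $$\mathbf v^a_{(+)}=\begin{bmatrix}\rho\\ \vec v-2(\vec v\cdot\vec n)\vec n\\ T\\ \vec B-2(\vec B\cdot\vec n-\vec B^0\cdot\vec n)\vec n\\ \psi\end{bmatrix}.$$ Then the local Lax–Friedrichs dissipation operator $$\mathrm{DISS}^{a,\mathrm{LLF}}_{(-),(+)}=\tfrac12|\lambda|_{\max}\,\mathcal H(\mathbf v_{(-)},\mathbf v^a_{(+)})\,\left(\mathbf w_{(+)}-\mathbf w_{(-)}\right)$$ is entropy stable at the boundary, i.e. its contribution to the time derivative of the discrete entropy function is nonpositive: $$\mathbf w_{(-)}^T\,\mathrm{DISS}^{a,\mathrm{LLF}}_{(-),(+)}\le 0 .$$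
   Context: The discretization is written in one space dimension ($x=x_1$; vectors have three components); the wall normal is $\vec n=(1,0,0)$ at a right boundary and $\vec n=(-1,0,0)$ at a left boundary. Perfect gas: $p=\rho RT$, $R>0$, $\gamma>1$, $\mu_0>0$. Specific entropy $s=\frac R{\gamma-1}\ln(T/T^* )-R\ln(\rho/\rho^* )$ ($T^*,\rho^*$ reference constants). Entropy variables: $$\mathbf w^T=\left(\tfrac{\gamma R}{\gamma-1}-s-\tfrac{\|\vec v\|^2}{2T},\ \tfrac{\vec v}T,\ -\tfrac1T,\ \tfrac{\vec B}{\mu_0T},\ \tfrac\psi{\mu_0T}\right);$$ $\mathbf w_{(\pm)}$ are the entropy variables of $\mathbf v_{(-)}$ and $\mathbf v^a_{(+)}$. $|\lambda|_{\max}\ge0$ is the maximum absolute eigenvalue of the flux Jacobian considering both states. The matrix $\mathcal H=\mathcal H(\mathbf v_i,\mathbf v_j)$ (a numerical entropy Jacobian) is the symmetric $9\times9$ matrix defined as follows. Let $\{\!\{a\}\!\}=\frac12(a_i+a_j)$, $a^{\ln}=(a_j-a_i)/(\ln a_j-\ln a_i)$ (equal to $a$ if $a_i=a_j=a$), $\beta=\rho/p$, $\overline p=\{\!\{\rho\}\!\}/\{\!\{\beta\}\!\}$, $\tau=\{\!\{\beta\}\!\}^{-1}$, $V^2=\{\!\{v_1\}\!\}^2+\{\!\{v_2\}\!\}^2+\{\!\{v_3\}\!\}^2$ and $$\overline E=\frac1{\gamma-1}\frac{\rho^{\ln}}{\beta^{\ln}}+\rho^{\ln}V^2-\rho^{\ln}\frac{\{\!\{v_1^2+v_2^2+v_3^2\}\!\}}2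 .$$ The entries of $R\mathcal H$ (symmetric) are, for $k,l\in\{1,2,3\}$: $(R\mathcal H)_{1,1}=\rho^{\ln}$; $(R\mathcal H)_{1,1+k}=\rho^{\ln}\{\!\{v_k\}\!\}$; $(R\mathcal H)_{1,5}=\overline E$; $(R\mathcal H)_{1+k,1+l}=\rho^{\ln}\{\!\{v_k\}\!\}\{\!\{v_l\}\!\}+\delta_{kl}\overline p$; $(R\mathcal H)_{1+k,5}=(\overline E+\overline p)\{\!\{v_k\}\!\}$; $(R\mathcal H)_{5,5+k}=\tau\{\!\{B_k\}\!\}$; $(R\mathcal H)_{5,9}=\tau\{\!\{\psi\}\!\}$; $(R\mathcal H)_{5+k,5+l}=\delta_{kl}\tau\mu_0$; $(R\mathcal H)_{9,9}=\tau\mu_0$; $$(R\mathcal H)_{5,5}=\tfrac12V^2(\overline E+\overline p)+\tau\left(\overline E+\frac{\{\!\{B_1\}\!\}^2+\{\!\{B_2\}\!\}^2+\{\!\{B_3\}\!\}^2}{\mu_0}+\frac{\{\!\{\psi\}\!\}^2}{\mu_0}\right);$$ all other entries not determined by symmetry are zero. Entropy contribution: in the semi-discrete entropy balance of a DG-SBP-SAT element, the advective dissipation operator at an end node (state $(-)$) facing a neighbouring/ghost state $(+)$ contributes $\mathbf w_{(-)}^T\mathrm{DISS}^a_{(-),(+)}$ to the time derivative of the discrete entropy. *)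

(* Defs.v *)
From mathcomp Require Import all_boot all_order all_algebra.
From mathcomp Require Import complex.
From mathcomp Require Import all_classical reals exp.

Set Implicit Arguments.
Unset Strict Implicit.
Unset Printing Implicit Defensive.

Import Order.TTheory GRing.Theory Num.Theory.
Local Open Scope classical_set_scope.
Local Open Scope ring_scope.

(* [psi] is the divergence-cleaning field of the GLM-MHD system. *)
Record prim (R : Type) := Prim {
  rho : R;
  vel : 'cV[R]_3;
  temp : R;
  mag : 'cV[R]_3;
  psi : R
}.

Definition dotv (R : realType) (a b : 'cV[R]_3) : R :=
  \sum_(i < 3) a i 0 * b i 0.

Definition avg (R : realType) (a b : R) : R := (a + b) / 2.
Definition avgv (R : realType) (a b : 'cV[R]_3) : 'cV[R]_3 := 2^-1 *: (a + b).

Definition logmean (R : realType) (a b : R) : R :=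
  if a == b then a else (b - a) / (ln b - ln a).

Definition pressure (R : realType) (Rg : R) (v : prim R) : R :=
  rho v * Rg * temp v.

Definition beta (R : realType) (Rg : R) (v : prim R) : R :=
  rho v / pressure Rg v.

Definition spec_entropy (R : realType) (Rg gamma Tref rhoref : R) (v : prim R)
    : R :=
  Rg / (gamma - 1) * ln (temp v / Tref) - Rg * ln (rho v / rhoref).

(* Nine-component vectors are assembled from blocks of heights 1,3,1,3,1;
   the height 1 + (3 + (1 + (3 + 1))) is convertible to 9. *)
Definition col5 (R : Type) (n : nat) (a : 'M[R]_(1, n)) (b : 'M[R]_(3, n))
    (c : 'M[R]_(1, n)) (d : 'M[R]_(3, n)) (e : 'M[R]_(1, n)) : 'M[R]_(9, n) :=
  col_mx a (col_mx b (col_mx c (col_mx d e))).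

Definition row5 (R : Type) (m : nat) (a : 'M[R]_(m, 1)) (b : 'M[R]_(m, 3))
    (c : 'M[R]_(m, 1)) (d : 'M[R]_(m, 3)) (e : 'M[R]_(m, 1)) : 'M[R]_(m, 9) :=
  row_mx a (row_mx b (row_mx c (row_mx d e))).

Definition entropy_vars (R : realType) (Rg gamma mu0 Tref rhoref : R)
    (v : prim R) : 'cV[R]_9 :=
  let T := temp v in
  col5 (gamma * Rg / (gamma - 1) - spec_entropy Rg gamma Tref rhoref v
          - dotv (vel v) (vel v) / (2 * T))%:M
       (T^-1 *: vel v)
       (- T^-1)%:M
       ((mu0 * T)^-1 *: mag v)
       (psi v / (mu0 * T))%:M.

(* Rg times the numerical entropy Jacobian [Hmx]. *)
Definition RH (R : realType) (Rg gamma mu0 : R) (vi vj : prim R) : 'M[R]_9 :=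
  let rholn := logmean (rho vi) (rho vj) in
  let betaln := logmean (beta Rg vi) (beta Rg vj) in
  let pbar := avg (rho vi) (rho vj) / avg (beta Rg vi) (beta Rg vj) in
  let tau := (avg (beta Rg vi) (beta Rg vj))^-1 in
  let v := avgv (vel vi) (vel vj) in
  let B := avgv (mag vi) (mag vj) in
  let ps := avg (psi vi) (psi vj) in
  let V2 := dotv v v in
  let Ebar := (gamma - 1)^-1 * (rholn / betaln) + rholn * V2
              - rholn * (avg (dotv (vel vi) (vel vi))
                             (dotv (vel vj) (vel vj)) / 2) in
  let H55 := 2^-1 * V2 * (Ebar + pbar)
             + tau * (Ebar + dotv B B / mu0 + ps ^+ 2 / mu0) in
  col5
    (row5 rholn%:M         (rholn *: v^T)
          Ebar%:M                 0                0)
    (row5 (rholn *: v)     (rholn *: (v *m v^T) + pbar%:M)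
          ((Ebar + pbar) *: v)    0                0)
    (row5 Ebar%:M          ((Ebar + pbar) *: v^T)
          H55%:M                  (tau *: B^T)     (tau * ps)%:M)
    (row5 0                0
          (tau *: B)              (tau * mu0)%:M   0)
    (row5 0                0
          (tau * ps)%:M           0                (tau * mu0)%:M).

Definition Hmx (R : realType) (Rg gamma mu0 : R) (vi vj : prim R) : 'M[R]_9 :=
  Rg^-1 *: RH Rg gamma mu0 vi vj.

(* The supremum is over the finite nonempty set of moduli of complex
   eigenvalues of A at the two states, so it is a maximum. Here [A v] is the
   flux Jacobian at state [v]; its entries enter only through this number, and
   no particular choice of flux is fixed. *)
Definition lambda_max (R : realType) (A : prim R -> 'M[R]_9) (vi vj : prim R)
    : R :=
  sup [set ComplexField.Normc.normc z | z in
        [set z : R[i] | eigenvalue (map_mx (real_complex R) (A vi)) z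
                     || eigenvalue (map_mx (real_complex R) (A vj)) z]].

Definition diss_LLF (R : realType) (Rg gamma mu0 Tref rhoref : R)
    (A : prim R -> 'M[R]_9) (vm vp : prim R) : 'cV[R]_9 :=
  let w := entropy_vars Rg gamma mu0 Tref rhoref in
  (2^-1 * lambda_max A vm vp) *: (Hmx Rg gamma mu0 vm vp *m (w vp - w vm)).

Variant wall := left_wall | right_wall.

Definition outward_normal (R : realType) (b : wall) : 'cV[R]_3 :=
  match b with
  | right_wall => delta_mx 0 0
  | left_wall => - delta_mx 0 0
  end.

Definition wall_ghost (R : realType) (n B0 : 'cV[R]_3) (v : prim R) : prim R :=
  Prim (rho v)
       (vel v - (2 * dotv (vel v) n) *: n)
       (temp v)
       (mag v - (2 * (dotv (mag v) n - dotv B0 n)) *: n)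
       (psi v).

(* Contribution of a dissipation vector at the end node in state [vm] to the
   time derivative of the discrete entropy. *)
Definition entropy_contribution (R : realType) (Rg gamma mu0 Tref rhoref : R)
    (vm : prim R) (diss : 'cV[R]_9) : R :=
  ((entropy_vars Rg gamma mu0 Tref rhoref vm)^T *m diss) 0 0.

(* Main.v *)
(* Reflection at the wall leaves density, temperature, [psi] and |v|^2
   unchanged, so the jump of the entropy variables lives in the normal velocity
   and normal magnetic components only, and the averaged velocity is tangential.
   On such a jump the entropy Jacobian acts almost diagonally: the only coupling
   left is the magnetic contribution to the energy row, which replaces B by
   B - {{B}}, i.e. by half the opposite of the magnetic jump. Hence the quadratic
   form is minus a sum of two squares with positive weights, namely
   (v.n)^2 and ((B - B0).n)^2. *)
Require Import Defs.
From mathcomp Require Import all_boot all_order all_algebra.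
From mathcomp Require Import all_classical reals exp.
From mathcomp Require Import complex ring.
Import Order.TTheory GRing.Theory Num.Theory.
Local Open Scope ring_scope.

Section BlockMatrices.
Variable R : realType.

(* The block sizes 9 = 1 + 8, 8 = 3 + 5, ... must be given explicitly, since
   unification cannot recover a splitting from the numeral 9. *)

Lemma col5B (n : nat) (a a' : 'M[R]_(1, n)) (b b' : 'M[R]_(3, n))
    (c c' : 'M[R]_(1, n)) (d d' : 'M[R]_(3, n)) (e e' : 'M[R]_(1, n)) :
  col5 a b c d e - col5 a' b' c' d' e' =
  col5 (a - a') (b - b') (c - c') (d - d') (e - e').
Proof.
by rewrite /col5 (@opp_col_mx _ 1 8) (@opp_col_mx _ 3 5) (@opp_col_mx _ 1 4)
  (@opp_col_mx _ 3 1) (@add_col_mx _ 1 8) (@add_col_mx _ 3 5)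
  (@add_col_mx _ 1 4) (@add_col_mx _ 3 1).
Qed.

Lemma tr_col5 (n : nat) (a : 'M[R]_(1, n)) (b : 'M[R]_(3, n))
    (c : 'M[R]_(1, n)) (d : 'M[R]_(3, n)) (e : 'M[R]_(1, n)) :
  (col5 a b c d e)^T = row5 a^T b^T c^T d^T e^T.
Proof.
by rewrite /col5 /row5 (@tr_col_mx _ 1 8) (@tr_col_mx _ 3 5) (@tr_col_mx _ 1 4)
  (@tr_col_mx _ 3 1).
Qed.

Lemma mul_col5 (n p : nat) (a : 'M[R]_(1, n)) (b : 'M[R]_(3, n))
    (c : 'M[R]_(1, n)) (d : 'M[R]_(3, n)) (e : 'M[R]_(1, n))
    (X : 'M[R]_(n, p)) :
  col5 a b c d e *m X = col5 (a *m X) (b *m X) (c *m X) (d *m X) (e *m X).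
Proof.
by rewrite /col5 (@mul_col_mx _ 1 8) (@mul_col_mx _ 3 5) (@mul_col_mx _ 1 4)
  (@mul_col_mx _ 3 1).
Qed.

Lemma mul_row5_col5 (m n : nat) (a : 'M[R]_(m, 1)) (b : 'M[R]_(m, 3))
    (c : 'M[R]_(m, 1)) (d : 'M[R]_(m, 3)) (e : 'M[R]_(m, 1))
    (a' : 'M[R]_(1, n)) (b' : 'M[R]_(3, n)) (c' : 'M[R]_(1, n))
    (d' : 'M[R]_(3, n)) (e' : 'M[R]_(1, n)) :
  row5 a b c d e *m col5 a' b' c' d' e' =
  a *m a' + (b *m b' + (c *m c' + (d *m d' + e *m e'))).
Proof.
by rewrite /row5 /col5 (@mul_row_col _ m 1 8) (@mul_row_col _ m 3 5)
  (@mul_row_col _ m 1 4) (@mul_row_col _ m 3 1).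
Qed.

End BlockMatrices.

Section DotProduct.
Variable R : realType.
Implicit Types (k : R) (x y z : 'cV[R]_3).

Lemma trmx_mul_dotv x y : x^T *m y = (dotv x y)%:M.
Proof.
apply/matrixP=> i j; rewrite !ord1 !mxE mulr1n /dotv.
by apply: eq_bigr => l _; rewrite !mxE.
Qed.

Lemma dotvC x y : dotv x y = dotv y x.
Proof. by apply: eq_bigr => i _; rewrite mulrC. Qed.

Lemma dotvBl x y z : dotv (x - y) z = dotv x z - dotv y z.
Proof. by rewrite /dotv -sumrB; apply: eq_bigr => i _; rewrite !mxE mulrBl. Qed.

Lemma dotvZl k x y : dotv (k *: x) y = k * dotv x y.
Proof. by rewrite /dotv mulr_sumr; apply: eq_bigr => i _; rewrite !mxE mulrA. Qed.

Lemma dotvBr x y z : dotv x (y - z) = dotv x y - dotv x z.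
Proof. by rewrite !(dotvC x) dotvBl. Qed.

Lemma dotvZr k x y : dotv x (k *: y) = k * dotv x y.
Proof. by rewrite !(dotvC x) dotvZl. Qed.

Definition dotvE := (dotvBl, dotvZl, dotvBr, dotvZr).

(** The cross term -4 (x·y)^2 cancels the square term 4 (x·y)^2 (y·y). *)
Lemma dotv_reflect x y : dotv y y = 1 ->
  dotv (x - (2 * dotv x y) *: y) (x - (2 * dotv x y) *: y) = dotv x x.
Proof. by move=> yy; rewrite !dotvE yy (dotvC y x); ring. Qed.

(** Serves both ghost components: it gives {{v}} = v - (v·n) n and {{B}} = B - (B·n - B0·n) n. *)
Lemma avgv_shift k x y : avgv x (x - (2 * k) *: y) = x - k *: y.
Proof. by apply/matrixP=> i j; rewrite !mxE; field. Qed.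

Lemma dotv_outward_normal b : dotv (outward_normal R b) (outward_normal R b) = 1.
Proof.
rewrite /dotv !big_ord_recl big_ord0.
by case: b; rewrite /= !mxE /= ?mulrNN; ring.
Qed.

End DotProduct.

Lemma avgxx (R : realType) (a : R) : avg a a = a.
Proof. by rewrite /avg; field. Qed.

Lemma beta_gt0 (R : realType) (Rg : R) (v : prim R) :
  0 < Rg -> 0 < rho v -> 0 < temp v -> 0 < beta Rg v.
Proof. by move=> *; rewrite /beta /pressure divr_gt0 ?mulr_gt0. Qed.

Lemma lambda_max_ge0 (R : realType) (A : prim R -> 'M[R]_9) (vi vj : prim R) :
  0 <= lambda_max A vi vj.
Proof.
(* [sup] is 0 when the set has no supremum. *)
rewrite /lambda_max; set E := (X in sup X).
have [[[x Ex] ubE]|/sup_out-> //] := pselect (has_sup E).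
apply: le_trans (ub_le_sup ubE Ex).
by case: Ex => -[a c] _ <-; rewrite /= sqrtr_ge0.
Qed.

(** The entries of [RH] that would carry [x] into the density and energy rows, and the rank-one part
    of the momentum block, all contain the factor {{v}}·x = 0. Only the pressure part of that block
    survives on [x]. *)
Lemma RH_mul_transverse (R : realType) (Rg gamma mu0 : R) (vi vj : prim R)
    (x y : 'cV[R]_3) :
  dotv (avgv (vel vi) (vel vj)) x = 0 ->
  let tau := (avg (beta Rg vi) (beta Rg vj))^-1 in
  RH Rg gamma mu0 vi vj *m col5 0 x 0 y 0 =
  col5 0 ((avg (rho vi) (rho vj) * tau) *: x)
       (tau * dotv (avgv (mag vi) (mag vj)) y)%:M ((tau * mu0) *: y) 0.
Proof.
move=> ux0 tau; rewrite /RH mul_col5 !mul_row5_col5 !mulmx0 !mul0mx.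
rewrite mulmxDl -?scalemxAl -mulmxA !trmx_mul_dotv ux0 !mul_scalar_mx.
by rewrite !scale_scalar_mx !mulr0 raddf0 ?mulmx0 ?scaler0 !addr0 !add0r.
Qed.

Section WallGhost.
Variables (R : realType) (Rg gamma mu0 Tref rhoref : R) (n B0 : 'cV[R]_3).
Variable v : prim R.
Hypotheses (hmu0 : 0 < mu0) (hT : 0 < temp v) (nn : dotv n n = 1).
Let va := wall_ghost n B0 v.
Let w := entropy_vars Rg gamma mu0 Tref rhoref.

(** The first component cancels because the specific entropy depends only on density and
    temperature, and reflection preserves |v|^2. *)
Lemma entropy_vars_jump :
  w va - w v =
  col5 0 ((- 2 * dotv (vel v) n / temp v) *: n) 0
       ((- 2 * (dotv (mag v) n - dotv B0 n) / (mu0 * temp v)) *: n) 0.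
Proof.
have T0 : temp v != 0 by rewrite gt_eqF.
have m0 : mu0 != 0 by rewrite gt_eqF.
rewrite /w /entropy_vars col5B /va /= dotv_reflect // /spec_entropy /= !subrr.
congr (col5 _ _ _ _ _); apply/matrixP=> i j; rewrite !mxE.
all: by field; rewrite ?T0 ?m0.
Qed.

Lemma entropy_form_wall :
  0 < Rg -> 0 < rho v ->
  ((w v)^T *m (RH Rg gamma mu0 v va *m (w va - w v))) 0 0 =
  - (2 / (beta Rg v * temp v ^+ 2) *
     (rho v * dotv (vel v) n ^+ 2
      + (dotv (mag v) n - dotv B0 n) ^+ 2 / mu0)).
Proof.
move=> hRg hrho.
have T0 : temp v != 0 by rewrite gt_eqF.
have m0 : mu0 != 0 by rewrite gt_eqF.
have b0 : beta Rg v != 0 by rewrite gt_eqF ?beta_gt0.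
(* [beta] reads only density and temperature, which the ghost state copies. *)
have ba : beta Rg va = beta Rg v by [].
rewrite entropy_vars_jump RH_mul_transverse /=; last first.
  (* The averaged velocity v - (v·n) n is orthogonal to n, hence to the velocity jump. *)
  by rewrite avgv_shift !dotvE nn; ring.
rewrite ba !avgxx avgv_shift /w /entropy_vars tr_col5 mul_row5_col5.
rewrite !mulmx0 !add0r addr0.
(* The energy term -(tau/T) {{B}}·y and the magnetic term (tau/T) B·y, with y the magnetic jump, are
   added here. *)
rewrite !trmx_mul_dotv tr_scalar_mx mul_scalar_mx scale_scalar_mx -!raddfD /=.
rewrite mxE mulr1n !dotvE nn.
by field; rewrite ?T0 ?m0 ?b0.
Qed.

End WallGhost.

Theorem theorem4 (R : realType) (Rg gamma mu0 Tref rhoref : R)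
    (hRg : 0 < Rg) (hgamma : 1 < gamma) (hmu0 : 0 < mu0)
    (hTref : 0 < Tref) (hrhoref : 0 < rhoref)
    (A : prim R -> 'M[R]_9) (* flux Jacobian *)
    (b : wall) (B0 : 'cV[R]_3)
    (v : prim R) (hrho : 0 < rho v) (hT : 0 < temp v) :
  let va := wall_ghost (outward_normal R b) B0 v in
  entropy_contribution Rg gamma mu0 Tref rhoref v
    (diss_LLF Rg gamma mu0 Tref rhoref A v va) <= 0.
Proof.
lazy zeta; rewrite /entropy_contribution /diss_LLF /Hmx.
rewrite -scalemxAl -!scalemxAr scalerA mxE.
rewrite entropy_form_wall ?dotv_outward_normal //.
(* What remains is the sign of [Rg], of the common weight's denominator and of the two squared
   terms. *)
rewrite !mulrN oppr_le0 !mulr_ge0 ?invr_ge0 ?lambda_max_ge0 ?addr_ge0 //.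
- exact: ltW.
- by rewrite mulr_ge0 ?sqr_ge0 ?ltW ?beta_gt0.
- by rewrite mulr_ge0 ?sqr_ge0 ?ltW.
- by rewrite divr_ge0 ?sqr_ge0 ?ltW.
Qed.
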